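(* Let $F=F(X)$ be a free group on a finite set $X$, let $h_1,\dots,h_m\in F\setminus\{\varepsilon\}$, let $H=\langle h_1,\dots,h_m\rangle\le F$, and let $w\in H$. Let $u=\mathrm{Geodesic}(h_1,\dots,h_m,w)$ be the output of the algorithm Geodesic. Then $\gamma(u)=w$ and $u$ is a shortest element of the free group $F(h_1,\dots,h_m)$ with this property; i.e., $u$ is a geodesic for $w$ with respect to the generators $h_1,\dots,h_m$ of $H$.
   Context: Elements of $F$ are freely reduced words over $X^{\pm1}$; $\varepsilon$ is the empty word. $F(h_1,\dots,h_m)$ is the free group on formal letters $h_1,\dots,h_m$, and $\gamma:F(h_1,\dots,h_m)\to H$ is the epimorphism with $\gamma(h_i)=h_i$. $|\cdot|$ denotes reduced word length in either free group. Labelled graphs. We consider finite directed graphs $(V,E)$ with labels $\mu:E\to X^{\pm1}\cup\{\varepsilon\}$ and $\nu:E\to F(h_1,\dots,h_m)$; multiple edges are allowed. Write $v_1\xrightarrow{x,u}v_2$ for an edge $e$ with origin $o(e)=v_1$, terminus $t(e)=v_2$, $\mu(e)=x$, $\nu(e)=u$. Bouquet. For $h_i=y_1\cdots y_n$ (reduced, $y_j\in X^{\pm1}$) let $\Gamma_{h_i}$ have vertices $0,\dots,n-1$ and edges: $j-1\xrightarrow{y_j,\varepsilon}j$ and $j\xrightarrow{y_j^{-1},\varepsilon}j-1$ for $1\le j<n$; $n-1\xrightarrow{y_n,h_i}0$ and $0\xrightarrow{y_n^{-1},h_i^{-1}}n-1$; and $j\xrightarrow{\varepsilon,\varepsilon}j$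 for $0\le j<n$. $\Gamma_0=\mathrm{Bouquet}(h_1,\dots,h_m)$ is obtained by merging $\Gamma_{h_1},\dots,\Gamma_{h_m}$ at the vertex $0$. Complete. Consecutive edges $e_1=v_1\to v_2$, $e_2=v_2\to v_3$ in $\Gamma$ form a potential bypass if $|\mu(e_1)\mu(e_2)|\le1$ (product in $F$) and $\Gamma$ has no edge $e=v_1\to v_3$ with $\mu(e)=\mu(e_1)\mu(e_2)$. The algorithm $\mathrm{Complete}(\Gamma)$: while $\Gamma$ contains potential bypasses, choose one, $e_1,e_2$, with the least $|\nu(e_1)\nu(e_2)|$ (ties broken arbitrarily), and add a new edge $e=o(e_1)\to t(e_2)$ with $\mu(e)=\mu(e_1)\mu(e_2)$, $\nu(e)=\nu(e_1)\nu(e_2)$. Return the resulting graph. Geodesic. On input $h_1,\dots,h_m$ and a reduced word $w=x_{i_1}^{\varepsilon_1}\cdots x_{i_n}^{\varepsilon_n}$: compute $\Gamma_0=\mathrm{Bouquet}(h_1,\dots,h_m)$ and $\Gamma=\mathrm{Complete}(\Gamma_0)$ with vertex set $V$; set $S=\{(0,\varepsilon)\}\subseteq V\times F(h_1,\dots,h_m)$. For $j=1,\dots,n$: let $S'$ be the set of all $(t(e),u\,\nu(e))$ with $(v,u)\in S$ and $e$ an edge of $\Gamma$ with $o(e)=v$, $\mu(e)=x_{i_j}^{\varepsilon_j}$; then replace $S$ by a set containing, for each $v\in V$ occurring as first coordinate in $S'$, exactly one pair $(v,u)\in S'$ with $|u|$ least. Finally find the pair $(0,u)\in S$ and return $u$.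 *)

(* Defs.v *)
From HB Require Import structures.
From mathcomp Require Import all_boot.

Set Implicit Arguments.
Unset Strict Implicit.
Unset Printing Implicit Defensive.

Local Open Scope group_scope.

(* [(x, true)] is the letter x and [(x, false)] is the letter x^-1. *)
Notation letter T := (T * bool)%type.

Section FreeGroup.

Variable T : choiceType.
Local Notation letter := (letter T).

Definition linv (a : letter) : letter := (a.1, ~~ a.2).

Definition reduced : pred (seq letter) := sorted (fun a b => b != linv a).

Definition push (a : letter) (s : seq letter) : seq letter :=
  if s is b :: s' then if b == linv a then s' else a :: s else [:: a].

Definition reduce (s : seq letter) : seq letter := foldr push [::] s.

Lemma linvK : involutive linv.
Proof. by case=> x b; rewrite /linv /= negbK. Qed.

Lemma reduced_behead a s : reduced (a :: s) -> reduced s.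
Proof. by case: s => //= b s /andP[]. Qed.

Lemma push_reduced a s : reduced s -> reduced (push a s).
Proof.
case: s => //= b s; case: ifPn => [_ |ne_ba] red_s; last by rewrite /= ne_ba.
exact: (reduced_behead (a := b)).
Qed.

Lemma reduce_reduced s : reduced (reduce s).
Proof. by elim: s => //= a s IHs; apply: push_reduced. Qed.

Lemma push_cons a s : reduced (a :: s) -> push a s = a :: s.
Proof. by case: s => //= b s /andP[/negPf->]. Qed.

Lemma reduce_id s : reduced s -> reduce s = s.
Proof.
elim: s => //= a s IHs red_as; rewrite IHs ?push_cons //.
exact: reduced_behead red_as.
Qed.

Lemma pushK a s : reduced s -> push (linv a) (push a s) = s.
Proof.
case: s => [|b s] /=; first by rewrite linvK eqxx.
case: ifP => [/eqP-> |_] red_s; last by rewrite /= linvK eqxx.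
exact: push_cons.
Qed.

Lemma foldr_push_reduced s t : reduced t -> reduced (foldr push t s).
Proof. by move=> red_t; elim: s => //= a s; apply: push_reduced. Qed.

Lemma foldr_push a s t :
  reduced t -> foldr push t (push a s) = push a (foldr push t s).
Proof.
move=> red_t; case: s => //= b s; case: ifP => //= /eqP->.
have := pushK (linv a) (foldr_push_reduced s red_t).
by rewrite linvK => ->.
Qed.

Lemma foldr_push_reduce s t :
  reduced t -> foldr push t (reduce s) = foldr push t s.
Proof. by move=> red_t; elim: s => //= a s IHs; rewrite foldr_push ?IHs. Qed.

Lemma reduce_cat s t : reduce (s ++ t) = foldr push (reduce t) s.
Proof. exact: foldr_cat. Qed.

Lemma reduce_catl s t : reduce (reduce s ++ t) = reduce (s ++ t).
Proof. by rewrite !reduce_cat foldr_push_reduce ?reduce_reduced. Qed.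

Lemma reduce_catr s t : reduce (s ++ reduce t) = reduce (s ++ t).
Proof. by rewrite !reduce_cat (reduce_id (reduce_reduced t)). Qed.

Lemma reduce_catV s : reduce (rev (map linv s) ++ s) = [::].
Proof.
elim: s => //= a s IHs; rewrite rev_cons cat_rcons reduce_cat /=.
by rewrite pushK ?reduce_reduced // -reduce_cat.
Qed.

Record free_group : Type :=
  FreeWord { fword :> seq letter; _ : reduced fword }.

HB.instance Definition _ := [isSub for fword].
HB.instance Definition _ := [Choice of free_group by <:].

Definition free_one : free_group := @FreeWord [::] isT.
Definition free_mul (u v : free_group) : free_group :=
  FreeWord (reduce_reduced (u ++ v)).
Definition free_inv (u : free_group) : free_group :=
  FreeWord (reduce_reduced (rev (map linv u))).

Lemma free_mulA : associative free_mul.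
Proof.
by move=> u v w; apply/val_inj; rewrite /= reduce_catl reduce_catr catA.
Qed.

Lemma free_mul1 : left_id free_one free_mul.
Proof. by move=> u; apply/val_inj; rewrite /= (reduce_id (valP u)). Qed.

Lemma free_mulg1 : right_id free_one free_mul.
Proof. by move=> u; apply/val_inj; rewrite /= cats0 (reduce_id (valP u)). Qed.

Lemma free_mulV : left_inverse free_one free_inv free_mul.
Proof. by move=> u; apply/val_inj; rewrite /= reduce_catl reduce_catV. Qed.

Lemma free_mulgV : right_inverse free_one free_inv free_mul.
Proof.
move=> u; apply/val_inj; rewrite /= reduce_catr.
have {1}-> : fword u = rev (map linv (rev (map linv u))).
  by rewrite map_rev revK (mapK linvK).
exact: reduce_catV.
Qed.

HB.instance Definition _ := isGroup.Build free_group
  free_mulA free_mul1 free_mulg1 free_mulV free_mulgV.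

Definition of_letter (a : letter) : free_group := @FreeWord [:: a] isT.

Definition gen (x : T) : free_group := of_letter (x, true).

(* The formal letter in [T^{+-1} \cup {1}] viewed as an element of the group. *)
Definition of_label (l : option letter) : free_group := oapp of_letter 1 l.

End FreeGroup.

(* The subgroup of [G] generated by the family [h]. *)
Inductive generated (G : groupType) (I : Type) (h : I -> G) : G -> Prop :=
  | generated_gen i : generated h (h i)
  | generated1 : generated h 1
  | generatedM g1 g2 :
      generated h g1 -> generated h g2 -> generated h (g1 * g2)
  | generatedV g : generated h g -> generated h g^-1.

(* The morphism from the free group on the formal letters [I] to [G] sending  *)
(* the letter [i] to [h i]; its image is [generated h].                       *)
Definition gamma (I : choiceType) (G : groupType) (h : I -> G)
    (u : free_group I) : G :=
  \prod_(a <- u) (if a.2 then h a.1 else (h a.1)^-1).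

Section GammaMorphism.

Variables (I : choiceType) (G : groupType) (h : I -> G).

Lemma gamma_gen i : gamma h (gen i) = h i.
Proof. by rewrite /gamma big_seq1. Qed.

Lemma gammaM : {morph gamma h : u v / u * v}.
Proof.
pose f (a : letter I) := if a.2 then h a.1 else (h a.1)^-1.
have pushE a s : \prod_(b <- push a s) f b = f a * \prod_(b <- s) f b.
  case: s => [|b s] /=; first by rewrite big_seq1 big_nil mulg1.
  case: ifP => [/eqP-> |_]; last by rewrite !big_cons.
  rewrite big_cons; case: a => x [] /=; rewrite /f /= mulgA ?mulgV ?mulVg;
  by rewrite mul1g.
move=> u v; rewrite /gamma -!/(f _) -big_cat /=.
by elim: (_ ++ _) => //= a s IHs; rewrite pushE IHs big_cons.
Qed.

End GammaMorphism.

Section LabelledGraphs.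

Variables (V : finType) (X Y : choiceType).

Record edge : Type := Edge {
  org : V;
  mu : option (letter X);
  nu : free_group Y;
  tgt : V
}.

Definition edge_tuple (e : edge) := (org e, mu e, nu e, tgt e).
Definition tuple_edge t : edge := let: (v, x, u, v') := t in Edge v x u v'.
Lemma edge_tupleK : cancel edge_tuple tuple_edge. Proof. by case. Qed.
HB.instance Definition _ := Choice.copy edge (can_type edge_tupleK).

(* A finite labelled graph on the vertex set [V], as its list of edges. *)
Definition lgraph : Type := seq edge.

Definition potential_bypass (Gm : lgraph) (e1 e2 : edge) : Prop :=
  let x := of_label (mu e1) * of_label (mu e2) in
  [/\ e1 \in Gm, e2 \in Gm, tgt e1 = org e2, size x <= 1 &
      ~ exists2 e, e \in Gm &
          [/\ org e = org e1, tgt e = tgt e2 & of_label (mu e) = x]].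

Definition least_bypass (Gm : lgraph) (e1 e2 : edge) : Prop :=
  potential_bypass Gm e1 e2 /\
  forall f1 f2, potential_bypass Gm f1 f2 ->
    size (nu e1 * nu e2) <= size (nu f1 * nu f2).

(* One iteration of the loop of Complete, with ties broken arbitrarily. *)
Definition complete_step (Gm Gm' : lgraph) : Prop :=
  exists e1 e2 e : edge,
    [/\ least_bypass Gm e1 e2,
        org e = org e1 /\ tgt e = tgt e2,
        of_label (mu e) = of_label (mu e1) * of_label (mu e2),
        nu e = nu e1 * nu e2 &
        Gm' = e :: Gm].

(* [complete Gm Gm'] : some execution of Complete on [Gm] returns [Gm']. *)
Inductive complete (Gm : lgraph) : lgraph -> Prop :=
  | complete_return :
      ~ (exists e1 e2, potential_bypass Gm e1 e2) -> complete Gm Gm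
  | complete_loop Gm' Gm'' :
      complete_step Gm Gm' -> complete Gm' Gm'' -> complete Gm Gm''.

(* Finite subsets of [V * free_group Y] are lists up to membership. *)
Definition successors (Gm : lgraph) (y : letter X)
    (S : seq (V * free_group Y)) : seq (V * free_group Y) :=
  [seq (tgt e, p.2 * nu e)
     | p <- S, e <- [seq e <- Gm | (org e == p.1) && (mu e == Some y)]].

Definition selection (S' S : seq (V * free_group Y)) : Prop :=
  [/\ {subset S <= S'},
      forall p, p \in S' -> exists q, q \in S /\ q.1 = p.1,
      forall p q, p \in S -> q \in S -> p.1 = q.1 -> p = q &
      forall p q, p \in S -> q \in S' -> p.1 = q.1 -> size p.2 <= size q.2].

(* The loop over the letters of the input word, from [S] to the final set. *)
Inductive geodesic_loop (Gm : lgraph) :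
    seq (letter X) -> seq (V * free_group Y) -> seq (V * free_group Y) ->
    Prop :=
  | geodesic_loop_nil S : geodesic_loop Gm [::] S S
  | geodesic_loop_cons y w S S1 S2 :
      selection (successors Gm y S) S1 -> geodesic_loop Gm w S1 S2 ->
      geodesic_loop Gm (y :: w) S S2.

End LabelledGraphs.

(* The cycle of a reduced word [s] of length n, labelled on the edge closing  *)
(* it by [c]: the edges indexed by [j : 'I_n] read the letter of index [j]    *)
(* forwards and backwards between [j] and its cyclic successor [ordS j].      *)
Definition cycle_graph (X Y : choiceType) (s : seq (letter X))
    (c : free_group Y) : lgraph 'I_(size s) X Y :=
  flatten [seq
    let y := tnth (in_tuple s) j in
    let d := if j.+1 == size s then c else 1 in
    [:: Edge j (Some y) d (ordS j);
        Edge (ordS j) (Some (linv y)) d^-1 j;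
        Edge j None 1 j]
  | j <- enum 'I_(size s)].

Section Geodesic.

Variables (X : finType) (m : nat) (h : 'I_m -> free_group X).

(* The vertex 0, common to all cycles, is [None]; the other vertices are the  *)
(* nonzero vertices [j] of the [i]-th cycle.                                  *)
Definition bouquet_vertex : finType :=
  option {p : {i : 'I_m & 'I_(size (h i))} | 0 < tagged p}.

Definition merge_vertex (i : 'I_m) (j : 'I_(size (h i))) : bouquet_vertex :=
  insub (Tagged (fun i => 'I_(size (h i))) j).

Definition bouquet : lgraph bouquet_vertex X 'I_m :=
  flatten [seq
    [seq Edge (merge_vertex (org e)) (mu e) (nu e) (merge_vertex (tgt e))
       | e <- cycle_graph (h i) (gen i)]
  | i <- enum 'I_m].

(* The final sets S reached by the executions of the algorithm Geodesic. *)
Definition geodesic_exec (w : free_group X)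
    (S : seq (bouquet_vertex * free_group 'I_m)) : Prop :=
  exists2 Gm, complete bouquet Gm &
    geodesic_loop Gm w [:: (None : bouquet_vertex, 1)] S.

(* [Geodesic w u] : some execution, with ties broken in some way, returns u. *)
Definition Geodesic (w : free_group X) (u : free_group 'I_m) : Prop :=
  exists2 S, geodesic_exec w S & (None : bouquet_vertex, u) \in S.

(* Whatever the choices, the algorithm terminates and finds a pair (0, u). *)
Definition geodesic_halts (w : free_group X) : Prop :=
  Acc (fun Gm' Gm => complete_step Gm Gm') bouquet /\
  forall S, geodesic_exec w S ->
    exists u, (None : bouquet_vertex, u) \in S.

End Geodesic.

(* Main.v *)
Require Import Defs.
From HB Require Import structures.
From mathcomp Require Import all_boot.

Set Implicit Arguments.
Unset Strict Implicit.
Unset Printing Implicit Defensive.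

(**
Let g_v be the element of F spelled by the prefix of h_i that leads from the
vertex 0 to the vertex v of the i-th cycle.  Say that u in F(h_1, ..., h_m)
realizes (v, x, v') when g_v x = gamma(u) g_v'.  The argument replaces all
statements about walks in the graphs by this relation: it is compatible with
products and inverses, every edge of the bouquet satisfies it (its label nu
realizes its ends and its label mu), and conversely every u realizing
(v, x, v') comes from a walk from v to v' in the bouquet with label x, which
goes back to 0, runs along the petals spelling u and then goes out to v'.  The
edges with nu nontrivial are crossed exactly |u| times on such a walk
([reach_bouquet]), so that the cost of a walk, the sum of the |nu(e)|, attains
the length of the shortest realizing element.

Call an edge geodesic when its nu is a shortest element realizing its ends and
its mu.  The key fact is that the loop of Complete keeps all edges geodesic
([complete_step_sound]).  If the new edge were not geodesic, a bouquet walk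
with the same ends and label would be cheaper than the least potential bypass.
As long as such a walk has two consecutive edges whose labels multiply to a
letter or to 1, those are not a potential bypass, because they are too cheap;
so some edge replaces them, and being geodesic it does not raise the cost
([contract_walk]).  The walk thus shrinks to at most one edge, which
contradicts the absence of an edge that makes a potential bypass.

In the completed graph there is no potential bypass at all, and the same
contraction turns a bouquet walk for any u with gamma(u) = w into a closed walk
at 0 that reads the reduced word w letter by letter, at cost at most |u|
([complete_closed_walk]).  The loop of Geodesic follows that walk: by induction
on w, the element it keeps at each vertex of the walk is at most as long as the
cost so far ([geodesic_loop_walk]).  Since all the elements it keeps are also
sound ([geodesic_loop_sound]), its output is a shortest preimage of w.
*)

Local Open Scope group_scope.

(** * Words *)

Section Words.

Variable T : choiceType.
Implicit Types (s : seq (letter T)) (u v : free_group T).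

Lemma size_push a s : size (push a s) <= (size s).+1.
Proof.
by case: s => //= b s; case: ifP => //= _; apply: leq_trans (leqnSn _).
Qed.

Lemma size_reduce s : size (reduce s) <= size s.
Proof. by elim: s => //= a s IHs; apply: leq_trans (size_push _ _) _. Qed.

Lemma size_mul u v : size (u * v) <= size u + size v.
Proof. by rewrite -size_cat; apply: size_reduce. Qed.

Lemma size_inv u : size u^-1 = size u.
Proof.
have le_inv v : size v^-1 <= size v.
  by apply: leq_trans (size_reduce _) _; rewrite size_rev size_map.
by apply/eqP; rewrite eqn_leq le_inv -{1}[u]invgK le_inv.
Qed.

Lemma size0_free u : size u = 0 -> u = 1.
Proof. by move=> u0; apply/val_inj/size0nil. Qed.

Lemma fword_prod s : fword (\prod_(a <- s) of_letter a) = reduce s.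
Proof.
elim: s => [|a s IHs]; first by rewrite big_nil.
by rewrite big_cons /= IHs (reduce_id (reduce_reduced s)).
Qed.

Lemma prod_fword u : \prod_(a <- u) of_letter a = u.
Proof. by apply/val_inj; rewrite /= fword_prod (reduce_id (valP u)). Qed.

Lemma of_letter_linv (a : letter T) : of_letter (linv a) = (of_letter a)^-1.
Proof.
apply: (mulIg (of_letter a)); rewrite mulVg; apply/val_inj => /=.
by rewrite linvK eqxx.
Qed.

End Words.

Section Gamma.

Variables (I : choiceType) (G : groupType) (h : I -> G).

Lemma gamma1 : gamma h 1 = 1.
Proof. by rewrite /gamma big_nil. Qed.

Lemma gammaV u : gamma h u^-1 = (gamma h u)^-1.
Proof. by apply: (mulIg (gamma h u)); rewrite -gammaM !mulVg gamma1. Qed.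

Lemma generated_gamma g : generated h g -> exists u, gamma h u = g.
Proof.
elim=> [i||_ _ _ [u <-] _ [v <-]|_ _ [u <-]].
- by exists (gen i); rewrite gamma_gen.
- by exists 1; rewrite gamma1.
- by exists (u * v); rewrite gammaM.
- by exists u^-1; rewrite gammaV.
Qed.

End Gamma.

(** * Walks in labelled graphs *)

Lemma sorted_or_break (T : Type) (r : rel T) (s : seq T) :
  sorted r s \/ exists s1 a b s2, s = s1 ++ [:: a, b & s2] /\ ~~ r a b.
Proof.
elim: s => [|a [|b s] IHs]; [by left| by left|].
case: (boolP (r a b)) => rab; last by right; exists [::], a, b, s.
case: IHs => [sbs|[s1 [c [d [s2 [-> rcd]]]]]]; first by left; rewrite /= rab.
by right; exists (a :: s1), c, d, s2.
Qed.

Section Walks.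

Variables (V : finType) (X Y : choiceType).
Implicit Types (Gm : lgraph V X Y) (e : edge V X Y) (p q : seq (edge V X Y)).

Fixpoint walk Gm v p v' : bool :=
  if p is e :: p' then [&& e \in Gm, org e == v & walk Gm (tgt e) p' v']
  else v == v'.

Definition walk_label p : free_group X := \prod_(e <- p) of_label (mu e).

(** This is the length before any free reduction between the labels of the
    edges, hence an upper bound on the length of the product of the labels. *)
Definition walk_cost p : nat := (\sum_(e <- p) size (nu e))%N.

Lemma walk_cat Gm v p q v' :
  walk Gm v (p ++ q) v' <-> exists2 v1, walk Gm v p v1 & walk Gm v1 q v'.
Proof.
elim: p v => [|e p IHp] v /=.
  by split=> [|[v1 /eqP->]] //; exists v; rewrite ?eqxx.
split=> [/and3P[-> -> /IHp[v1 pP qP]]|[v1 /and3P[-> -> pP] qP]].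
  by exists v1.
by apply/IHp; exists v1.
Qed.

Lemma walk_sub Gm Gm' v p v' :
  {subset Gm <= Gm'} -> walk Gm v p v' -> walk Gm' v p v'.
Proof.
move=> sub; by elim: p v => //= e p IHp v /and3P[/sub-> -> /IHp].
Qed.

(** The cost is only bounded from above, so that walks compose with the bounds
    at hand. *)
Definition reach Gm v x v' c : Prop :=
  exists p, [/\ walk Gm v p v', walk_label p = x & walk_cost p <= c].

Lemma reach_refl Gm v : reach Gm v 1 v 0.
Proof. by exists [::]; rewrite /walk_label /walk_cost !big_nil /= eqxx. Qed.

Lemma reach_edge Gm e :
  e \in Gm -> reach Gm (org e) (of_label (mu e)) (tgt e) (size (nu e)).
Proof.
move=> eG; exists [:: e].
by rewrite /walk_label /walk_cost !big_seq1 /= eG !eqxx.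
Qed.

Lemma reach_trans Gm v1 v2 v3 x y c d :
  reach Gm v1 x v2 c -> reach Gm v2 y v3 d -> reach Gm v1 (x * y) v3 (c + d).
Proof.
case=> p [pP <- pc] [q [qP <- qd]]; exists (p ++ q); split.
- by apply/walk_cat; exists v2.
- by rewrite /walk_label big_cat.
- by rewrite /walk_cost big_cat leq_add.
Qed.

Definition einv e : edge V X Y :=
  Edge (tgt e) (omap (@linv X) (mu e)) (nu e)^-1 (org e).

Lemma of_label_einv e : of_label (mu (einv e)) = (of_label (mu e))^-1.
Proof. by case: e => v [a|] u v' /=; rewrite ?of_letter_linv ?invg1. Qed.

Lemma reach_inv Gm v x v' c :
  {in Gm, forall e, einv e \in Gm} -> reach Gm v x v' c ->
  reach Gm v' x^-1 v c.
Proof.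
move=> symG [p [pP <-]].
elim: p v c pP => [|e p IHp] v c /=.
  move/eqP=> -> _; rewrite /walk_label big_nil invg1; exists [::].
  by rewrite /walk_label /walk_cost !big_nil /= eqxx.
case/and3P=> eG /eqP<- pP; rewrite /walk_cost big_cons => le_c.
rewrite /walk_label big_cons invgM.
have [q [qP qx qc]] :=
  reach_trans (IHp _ _ pP (leqnn _)) (reach_edge (symG e eG)).
exists q; split=> //; first by rewrite qx of_label_einv.
by apply: leq_trans qc _; rewrite size_inv addnC.
Qed.

Definition irreducible_pair e1 e2 : bool :=
  1 < size (of_label (mu e1) * of_label (mu e2)).

Lemma irreducible_pairP e1 e2 : irreducible_pair e1 e2 ->
  exists a b, [/\ mu e1 = Some a, mu e2 = Some b & b != linv a].
Proof.
rewrite /irreducible_pair; case: (mu e1) (mu e2) => [a|] [b|] //=.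
by case: ifPn => // ne_ba _; exists a, b.
Qed.

(** Consecutive labels whose product is longer than 1 are letters that do not
    cancel.  Hence the labels of a walk without contractible pair form a reduced
    word, and the empty label can only occur on a walk with a single edge. *)
Lemma irreducible_walk p : sorted irreducible_pair p ->
  (exists2 e, p = [:: e] & mu e = None) \/
  map (@mu V X Y) p = map Some (walk_label p).
Proof.
case: p => [|e [|e1 p]] irr_p; first by right; rewrite /walk_label big_nil.
  rewrite /walk_label big_seq1 /=; case mu_e: (mu e) => [a|]; first by right.
  by left; exists e.
have [s [mu_s red_s]] : exists s,
    map (@mu V X Y) [:: e, e1 & p] = map Some s /\ reduced s.
  elim: p e e1 irr_p => [|e2 p IHp] e e1 /=;
    case/andP=> /irreducible_pairP[a [b [-> mu_b ne_ba]]].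
    by rewrite mu_b => _; exists [:: a; b]; rewrite /= ne_ba.
  case/IHp=> -[|b' s] [] //= []; rewrite mu_b => -[<-] -> red_s.
  by exists [:: a, b & s]; rewrite /= ne_ba.
right; rewrite mu_s; congr map.
rewrite -(reduce_id red_s) -fword_prod /walk_label; congr fword.
by rewrite -(big_map (@mu V X Y) xpredT (@of_label X)) mu_s big_map.
Qed.

End Walks.

(** * Geodesic edges and the loop of Complete *)

Section Geodesics.

Variables (V : finType) (X Y : choiceType).
Variables (h : Y -> free_group X) (g : V -> free_group X).
Implicit Types (Gm : lgraph V X Y) (e : edge V X Y) (p q : seq (edge V X Y)).

(** With g v read as the label of a walk from a base vertex to v, this says that
    a walk from v to v' with label x, completed into a closed walk at the base
    vertex, spells the image of u. *)
Definition realizes v x v' (u : free_group Y) : Prop :=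
  g v * x = gamma h u * g v'.

Definition geodesic_edge e : Prop :=
  realizes (org e) (of_label (mu e)) (tgt e) (nu e) /\
  forall u, realizes (org e) (of_label (mu e)) (tgt e) u ->
    size (nu e) <= size u.

Definition geodesic_graph Gm : Prop := {in Gm, forall e, geodesic_edge e}.

Lemma realizesM v1 v2 v3 x y u1 u2 :
  realizes v1 x v2 u1 -> realizes v2 y v3 u2 ->
  realizes v1 (x * y) v3 (u1 * u2).
Proof.
by rewrite /realizes => r1 r2; rewrite mulgA r1 -mulgA r2 gammaM mulgA.
Qed.

Lemma realizesV v x v' u : realizes v x v' u -> realizes v' x^-1 v u^-1.
Proof.
rewrite /realizes gammaV => r; apply: (mulgI (gamma h u)).
by rewrite mulVKg mulgA -r mulgK.
Qed.

Lemma geodesic_einv e : geodesic_edge e -> geodesic_edge (einv e).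
Proof.
case=> real_e min_e; split; rewrite of_label_einv; first exact: realizesV.
move=> u /realizesV; rewrite invgK => /min_e.
by rewrite /= !size_inv.
Qed.

(** Among geodesic edges, replacing a contractible pair by an edge with the
    product label cannot raise the cost, as the product of the two values of nu
    also realizes that edge.  Such an edge exists unless the pair is a potential
    bypass; a walk cheaper than all potential bypasses contains none, and
    remains so after each replacement. *)
Lemma contract_walk Gm v p v' :
    geodesic_graph Gm ->
    (forall e1 e2, potential_bypass Gm e1 e2 ->
       walk_cost p < size (nu e1 * nu e2)) ->
    walk Gm v p v' ->
  exists q, [/\ walk Gm v q v', walk_label q = walk_label p,
    walk_cost q <= walk_cost p & sorted (@irreducible_pair V X Y) q].
Proof.
move=> geoG; have [n] := ubnP (size p); elim: n p => // n IHn p le_pn noB pP.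
have [irr_p|[p1 [e1 [e2 [p2 [def_p red12]]]]]] :=
  sorted_or_break (@irreducible_pair V X Y) p; first by exists p.
rewrite /irreducible_pair -leqNgt in red12.
move: (pP); rewrite {1}def_p => /walk_cat[v1 p1P /=].
case/and4P=> e1G /eqP def_v1 e2G.
case/andP=> /eqP tgt1 p2P.
have cost_p : walk_cost p = (walk_cost p1 + (size (nu e1) + size (nu e2)
    + walk_cost p2))%N.
  by rewrite def_p /walk_cost big_cat !big_cons /= !addnA.
pose is_shortcut e := [&& org e == org e1, tgt e == tgt e2 &
  of_label (mu e) == of_label (mu e1) * of_label (mu e2)].
have [/hasP[e eG /and3P[/eqP org_e /eqP tgt_e /eqP mu_e]]|no_e] :=
    boolP (has is_shortcut Gm); last first.
  have /noB : potential_bypass Gm e1 e2.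
    split=> // -[e eG [org_e tgt_e mu_e]]; case/hasP: no_e; exists e => //.
    by rewrite /is_shortcut org_e tgt_e mu_e !eqxx.
  rewrite ltnNge (leq_trans (size_mul _ _)) // cost_p.
  by rewrite (leq_trans _ (leq_addl _ _)) ?leq_addr.
have cost_e : size (nu e) <= size (nu e1) + size (nu e2).
  have [_ min_e] := geoG e eG.
  apply: leq_trans (size_mul _ _); apply: min_e; rewrite org_e tgt_e mu_e.
  have [r1 _] := geoG _ e1G; have [r2 _] := geoG _ e2G.
  by apply: realizesM r1 _; rewrite -tgt1.
have cost_q : walk_cost (p1 ++ e :: p2) <= walk_cost p.
  by rewrite cost_p /walk_cost big_cat big_cons /= leq_add2l leq_add2r.
have [||| q [qP lab_q le_q irr_q]] := IHn (p1 ++ e :: p2).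
- by move: le_pn; rewrite def_p !size_cat /= !addnS.
- by move=> f1 f2 /noB; apply: leq_ltn_trans.
- by apply/walk_cat; exists v1; rewrite //= eG org_e def_v1 eqxx tgt_e.
exists q; split=> //; last exact: leq_trans le_q cost_q.
by rewrite lab_q def_p /walk_label !big_cat !big_cons /= mu_e !mulgA.
Qed.

Variable Gm0 : lgraph V X Y.

Hypothesis Gm0_geodesic : geodesic_graph Gm0.
(* A contracted walk may be empty; such a loop then has its ends and label. *)
Hypothesis Gm0_loop :
  {in Gm0, forall e, Edge (org e) None 1 (org e) \in Gm0}.
Hypothesis Gm0_reach :
  forall v x v' u, realizes v x v' u -> reach Gm0 v x v' (size u).

Definition sound_extension Gm : Prop :=
  [/\ {subset Gm0 <= Gm}, geodesic_graph Gm &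
      {in Gm, forall e, Edge (org e) None 1 (org e) \in Gm}].

(** The greedy choice of a least bypass matters here: a realizing element
    shorter than the new label would come from a walk of the initial graph
    cheaper than every bypass, and contracting that walk would yield the very
    edge whose absence makes the bypass. *)
Lemma complete_step_sound Gm Gm' :
  sound_extension Gm -> complete_step Gm Gm' -> sound_extension Gm'.
Proof.
case=> subG geoG loopG [e1 [e2 [e [[byp least] [org_e tgt_e] mu_e nu_e ->]]]].
have [e1G e2G tgt1 small no_e] := byp.
split=> [f f0|f|f].
- by rewrite inE subG ?orbT.
- rewrite inE => /predU1P[->{f}|]; last exact: geoG.
  have real_e : realizes (org e) (of_label (mu e)) (tgt e) (nu e).
    have [r1 _] := geoG _ e1G; have [r2 _] := geoG _ e2G.
    rewrite org_e tgt_e mu_e nu_e; apply: realizesM r1 _.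
    by rewrite tgt1.
  split=> // u real_u; rewrite leqNgt; apply/negP => lt_u.
  have [p [/(walk_sub subG) pP lab_p cost_p]] := Gm0_reach real_u.
  have [f1 f2 byp_f|q [qP lab_q _ irr_q]] := contract_walk geoG _ pP.
    apply: leq_trans (least _ _ byp_f); rewrite -nu_e.
    exact: leq_ltn_trans lt_u.
  have lab_q2 : walk_label q = of_label (mu e1) * of_label (mu e2).
    by rewrite lab_q lab_p.
  have : size q <= 1.
    have [[f -> //]|/(congr1 size)] := irreducible_walk irr_q.
    by rewrite !size_map lab_q2 => ->.
  (* An empty walk forces equal ends and an empty label: a loop then does. *)
  case: q qP lab_q2 {irr_q lab_q} => [|f [|//]] /=; rewrite org_e tgt_e.
    move=> /eqP vv'; rewrite /walk_label big_nil => lab1 _.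
    by case: no_e; exists (Edge (org e1) None 1 (org e1)); rewrite ?loopG.
  case/and3P=> fG /eqP org_f /eqP tgt_f.
  rewrite /walk_label big_seq1 => mu_f _.
  by case: no_e; exists f.
- rewrite !inE => /predU1P[->{f}|/loopG->]; last by rewrite orbT.
  by rewrite org_e loopG ?orbT.
Qed.

Lemma complete_sound Gm : complete Gm0 Gm ->
  sound_extension Gm /\ ~ (exists e1 e2, potential_bypass Gm e1 e2).
Proof.
have : sound_extension Gm0 by split.
move: {1 2}Gm0 => Gm1 snd1 cG; elim: cG snd1 => // {}Gm1 Gm2 Gm3 step _ IH snd1.
exact/IH/(complete_step_sound snd1).
Qed.

(** Closed walks avoid an exception: if x = 1, the contraction may leave a
    single edge with empty label, which spells no letter, and only for equal
    ends can the empty walk replace it. *)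
Lemma complete_closed_walk Gm v (x : free_group X) u :
    complete Gm0 Gm -> realizes v x v u ->
  exists q, [/\ walk Gm v q v, map (@mu V X Y) q = map Some x &
                walk_cost q <= size u].
Proof.
case/complete_sound=> -[subG geoG _] noB real_u.
have [p [/(walk_sub subG) pP <- cost_p]] := Gm0_reach real_u.
have [e1 e2 byp|q [qP lab_q cost_q irr_q]] := contract_walk geoG _ pP.
  by case: noB; exists e1, e2.
have [[e def_q mu_e]|mu_q] := irreducible_walk irr_q; last first.
  by exists q; rewrite mu_q lab_q (leq_trans cost_q).
exists [::]; rewrite -lab_q def_q /walk_label /walk_cost big_nil big_seq1 mu_e.
by rewrite /= eqxx.
Qed.

End Geodesics.

Section Termination.

Variables (V : finType) (X : finType) (Y : choiceType).

Definition edge_key (e : edge V X Y) : V * V * option (letter X) :=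
  (org e, tgt e, mu e).

(** The triple of the new edge was absent, since otherwise the pair would not
    be a potential bypass, and there are finitely many triples. *)
Lemma complete_terminates (Gm : lgraph V X Y) :
  Acc (fun Gm2 Gm1 => complete_step Gm1 Gm2) Gm.
Proof.
pose missing (Gm : lgraph V X Y) :=
  [set k | k \notin map edge_key Gm].
have [n] := ubnP #|missing Gm|.
elim: n Gm => [|n IHn] Gm; first by rewrite ltn0.
move=> le_n; constructor=> Gm' [e1 [e2 [e []]]].
case=> -[_ _ _ _ no_e] _ [org_e tgt_e] mu_e _ ->.
rewrite ltnS in le_n; apply: IHn; apply: leq_trans le_n.
apply/proper_card/properP; split.
  by apply/subsetP=> k; rewrite !inE negb_or => /andP[].
exists (edge_key e); rewrite !inE ?eqxx //.
apply/mapP=> -[f fG [org_f tgt_f mu_f]]; case: no_e; exists f => //.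
by rewrite -org_f -tgt_f -mu_f.
Qed.

End Termination.

(** * The loop over the letters of the input word *)

Section Loop.

Variables (V : finType) (X Y : choiceType).
Implicit Types (Gm : lgraph V X Y) (S : seq (V * free_group Y)).

Lemma successorsP Gm y S v' u' :
  reflect (exists v u e, [/\ (v, u) \in S, e \in Gm, org e = v, mu e = Some y &
             v' = tgt e /\ u' = u * nu e])
          ((v', u') \in successors Gm y S).
Proof.
apply: (iffP allpairsPdep) => [[[v u] [e []]]|[v [u [e]]]].
  rewrite mem_filter => vS /andP[/andP[/eqP org_e /eqP mu_e] eG] [-> ->].
  by exists v, u, e.
case=> vS eG org_e mu_e [-> ->].
by exists (v, u), e; rewrite mem_filter org_e mu_e !eqxx.
Qed.

Lemma geodesic_loop_functional Gm w S S' :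
    geodesic_loop Gm w S S' ->
    {in S &, forall p q, p.1 = q.1 -> p = q} ->
  {in S' &, forall p q, p.1 = q.1 -> p = q}.
Proof.
elim=> // y {}w S0 S1 S2 [_ _ func1 _] _ IH _.
by apply: IH => p q pS qS; apply: func1.
Qed.

(** The invariant says that u realizes the word read so far, preceded by x, from
    the base vertex to v. *)
Lemma geodesic_loop_sound Gm w S S' (h : Y -> free_group X) g x :
    {in Gm, forall e, realizes h g (org e) (of_label (mu e)) (tgt e) (nu e)} ->
    geodesic_loop Gm w S S' ->
    {in S, forall p, gamma h p.2 * g p.1 = x} ->
  {in S', forall p, gamma h p.2 * g p.1 = x * \prod_(a <- w) of_letter a}.
Proof.
move=> realG loop; elim: loop x => [{}S|y {}w S0 S1 S2 sel _ IH] x soundS p.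
  by rewrite big_nil mulg1; apply: soundS.
rewrite big_cons mulgA; apply: IH => {p} -[v' u'].
case: sel => sub _ _ _ /sub/successorsP[v [u [e]]].
case=> vS eG org_e mu_e [-> ->] /=.
rewrite gammaM -mulgA -(realG e eG) mu_e org_e mulgA.
by rewrite (soundS _ vS).
Qed.

(** A pair kept at a vertex of the walk is at most as long as the extension by
    the next edge of the pair kept before, so lengths are compared with the cost
    of the walk, although reduced lengths are not additive. *)
Lemma geodesic_loop_walk Gm w S S' v u q v' :
    geodesic_loop Gm w S S' -> (v, u) \in S ->
    walk Gm v q v' -> map (@mu V X Y) q = map Some w ->
  exists2 u', (v', u') \in S' & size u' <= size u + walk_cost q.
Proof.
move=> loop; elim: loop v u q => [{}S|y {}w S0 S1 S2 sel _ IH] v u [|e q] //=.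
  by move=> vS /eqP<- _; exists u => //; rewrite leq_addr.
move=> vS /and3P[eG /eqP org_e qP] [mu_e mu_q].
have [_ total1 _ least1] := sel.
have succ_e : (tgt e, u * nu e) \in successors Gm y S0.
  by apply/successorsP; exists v, u, e.
have [[v1 u1] [v1S /= v1E]] := total1 _ succ_e; rewrite {}v1E in v1S.
have /= le_u1 := least1 _ _ v1S succ_e erefl.
have [u' u'S le_u'] := IH _ _ _ v1S qP mu_q; exists u' => //.
apply: leq_trans le_u' _; rewrite /walk_cost big_cons addnA leq_add2r.
exact: leq_trans le_u1 (size_mul _ _).
Qed.

End Loop.

(** * The bouquet *)

Section Bouquet.

Variables (X : finType) (m : nat) (h : 'I_m -> free_group X).

Local Notation base := (None : bouquet_vertex h).
Local Notation merge := (@merge_vertex X m h _).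

Definition prefix (i : 'I_m) (j : nat) : free_group X :=
  \prod_(a <- take j (h i)) of_letter a.

(** The element g_v: the label of the walk from 0 to v along the cycle of v that
    avoids its closing edge. *)
Definition spoke (v : bouquet_vertex h) : free_group X :=
  if v is Some p then prefix (tag (val p)) (tagged (val p)) else 1.

Lemma spoke_merge i (j : 'I_(size (h i))) : spoke (merge j) = prefix i j.
Proof.
rewrite /merge_vertex; case: insubP => [p _ def_p|]; first by rewrite /= def_p.
by rewrite -leqNgt leqn0 /= => /eqP->; rewrite /prefix take0 big_nil.
Qed.

Lemma merge0 i (j : 'I_(size (h i))) : j = 0 :> nat -> merge j = base.
Proof. by move=> j0; rewrite /merge_vertex insubF //= j0. Qed.

Definition bouquet_edge i (j : 'I_(size (h i))) :
    edge (bouquet_vertex h) X 'I_m :=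
  Edge (merge j) (Some (tnth (in_tuple (h i)) j))
    (if j.+1 == size (h i) then gen i else 1) (merge (ordS j)).

Lemma mem_bouquet e :
  e \in bouquet h <-> exists i (j : 'I_(size (h i))),
    [\/ e = bouquet_edge j, e = einv (bouquet_edge j) |
        e = Edge (merge j) None 1 (merge j)].
Proof.
split=> [/flatten_mapP[i _ /mapP[f /flatten_mapP[j _ /=]]]|[i [j edge_j]]].
  rewrite !inE => /or3P[] /eqP-> -> /=; exists i, j.
  - by apply: Or31.
  - by apply: Or32.
  - by apply: Or33.
apply/flatten_mapP; exists i; first by rewrite mem_enum.
case: edge_j => ->; apply/mapP;
  [exists (Edge j (Some (tnth (in_tuple (h i)) j))
             (if j.+1 == size (h i) then gen i else 1) (ordS j))
  |exists (Edge (ordS j) (Some (linv (tnth (in_tuple (h i)) j)))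
             (if j.+1 == size (h i) then gen i else 1)^-1 j)
  |exists (Edge j None 1 j)] => //;
  by apply/flatten_mapP; exists j; rewrite ?mem_enum // !inE eqxx ?orbT.
Qed.

Lemma prefixS i (j : 'I_(size (h i))) :
  prefix i j.+1 = prefix i j * of_letter (tnth (in_tuple (h i)) j).
Proof.
rewrite /prefix (take_nth (tnth (in_tuple (h i)) j)) // big_rcons.
by rewrite /= -(tnth_nth _ (in_tuple (h i))).
Qed.

Lemma prefix_size i : prefix i (size (h i)) = h i.
Proof. by rewrite /prefix take_size prod_fword. Qed.

Hypothesis hne : forall i, h i <> 1.

(** Only a closing edge needs an argument: its label nu has length 1, and if 1
    realized it too, then the whole word h_i would be trivial. *)
Lemma geodesic_bouquet_edge i (j : 'I_(size (h i))) :
  geodesic_edge h spoke (bouquet_edge j).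
Proof.
rewrite /geodesic_edge /realizes /= !spoke_merge -prefixS /=.
case: eqP => [last_j|/eqP not_last]; last first.
  by rewrite modn_small ?gamma1 ?mul1g // ltn_neqAle not_last /=.
rewrite last_j modnn prefix_size gamma_gen.
have -> : prefix i 0 = 1 by rewrite /prefix take0 big_nil.
split=> [|u]; first by rewrite mulg1.
rewrite mulg1 lt0n => def_hi; apply/eqP => /size0_free u1.
by case: (hne (i := i)); rewrite def_hi u1 gamma1.
Qed.

Lemma geodesic_bouquet : geodesic_graph h spoke (bouquet h).
Proof.
move=> e /mem_bouquet[i [j []]] ->; first exact: geodesic_bouquet_edge.
  exact/geodesic_einv/geodesic_bouquet_edge.
by split=> //; rewrite /realizes /= gamma1 mulg1 mul1g.
Qed.

Lemma bouquet_loop :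
  {in bouquet h, forall e, Edge (org e) None 1 (org e) \in bouquet h}.
Proof.
move=> e /mem_bouquet[i [j edge_j]]; apply/mem_bouquet; exists i.
case: edge_j => ->; [exists j|exists (ordS j)|exists j]; exact: Or33.
Qed.

Lemma bouquet_sym : {in bouquet h, forall e, einv e \in bouquet h}.
Proof.
move=> e /mem_bouquet[i [j edge_j]]; apply/mem_bouquet; exists i, j.
case: edge_j => ->; [exact: Or32|apply: Or31|apply: Or33].
  by rewrite /einv /= linvK invgK.
by rewrite /einv /= invg1.
Qed.

Lemma reach_bouquet_edge i (j : 'I_(size (h i))) :
  reach (bouquet h) (merge j) (of_letter (tnth (in_tuple (h i)) j))
    (merge (ordS j)) (j.+1 == size (h i)).
Proof.
have edge_j : bouquet_edge j \in bouquet h.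
  by apply/mem_bouquet; exists i, j; apply: Or31.
by have := reach_edge edge_j; rewrite /=; case: (_ == _).
Qed.

Lemma reach_merge i (j : 'I_(size (h i))) :
  reach (bouquet h) base (prefix i j) (merge j) 0.
Proof.
case: j => j; elim: j => [|j IHj] lt_j.
  by rewrite merge0 // /prefix take0 big_nil; apply: reach_refl.
have := reach_trans (IHj (ltnW lt_j))
  (reach_bouquet_edge (Ordinal (ltnW lt_j))).
rewrite -prefixS /= ltn_eqF //.
suff -> : ordS (Ordinal (ltnW lt_j)) = Ordinal lt_j by [].
by apply/val_inj; rewrite /= modn_small.
Qed.

Lemma reach_spoke v : reach (bouquet h) base (spoke v) v 0.
Proof.
case: v => [p|]; last exact: reach_refl.
have := reach_merge (tagged (val p)).
have -> : merge_vertex (tagged (val p)) = insub (val p) by case: (val p).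
by rewrite valK.
Qed.

Lemma reach_petal i : reach (bouquet h) base (h i) base 1.
Proof.
have size_gt0 : 0 < size (h i).
  by rewrite lt0n; apply/eqP => /size0_free; apply: hne.
have [j last_j] : exists j : 'I_(size (h i)), j.+1 = size (h i).
  have lt_pred : (size (h i)).-1 < size (h i) by rewrite prednK.
  by exists (Ordinal lt_pred); rewrite /= prednK.
have := reach_trans (reach_merge j) (reach_bouquet_edge j).
by rewrite -prefixS last_j prefix_size eqxx merge0 //= last_j modnn.
Qed.

(** The walk goes back from v to 0, runs along the petals spelling u, and goes
    out to v'; only the closing edges of the petals have a cost. *)
Lemma reach_bouquet v x v' u :
  realizes h spoke v x v' u -> reach (bouquet h) v x v' (size u).
Proof.
move=> real_u.
have reach_u : reach (bouquet h) base (gamma h u) base (size u).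
  rewrite /gamma; elim: (fword u) => [|[i b] s IHs].
    by rewrite big_nil; apply: reach_refl.
  rewrite big_cons [size _]/= -[(size s).+1]add1n; apply: reach_trans IHs.
  by case: b => /=; last apply: reach_inv bouquet_sym _; apply: reach_petal.
have := reach_trans (reach_inv bouquet_sym (reach_spoke v))
  (reach_trans reach_u (reach_spoke v')).
by rewrite -real_u mulKg add0n addn0.
Qed.

End Bouquet.

(** * Correctness of Geodesic *)

Theorem theorem6p5 (X : finType) (m : nat) (h : 'I_m -> free_group X)
    (hne : forall i, h i <> 1) (w : free_group X) (wH : generated h w) :
  geodesic_halts h w /\
  forall u : free_group 'I_m, Geodesic h w u ->
    gamma h u = w /\
    forall u' : free_group 'I_m, gamma h u' = w -> (size u <= size u')%N.
Proof.
(* Both the existence of an output and its minimality come from the walk that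
   reads w: the loop keeps at 0 an element at most as long as any u. *)
have exec_le S u : @geodesic_exec X m h w S -> gamma h u = w ->
    exists2 v, (None, v) \in S & size v <= size u.
  case=> Gm cG loop gam_u.
  have real_u : realizes h (@spoke _ _ h) None w None u.
    by rewrite /realizes gam_u mulg1 mul1g.
  have [q [qP mu_q cost_q]] := complete_closed_walk (geodesic_bouquet hne)
    (@bouquet_loop _ _ h) (reach_bouquet hne) cG real_u.
  have [v vS le_v] := geodesic_loop_walk loop (mem_head _ _) qP mu_q.
  by exists v; rewrite // (leq_trans le_v).
split.
  split=> [|S exS]; first exact: complete_terminates.
  have [u gam_u] := generated_gamma wH.
  by have [v vS _] := exec_le _ _ exS gam_u; exists v.
move=> u [S exS uS]; have [Gm cG loop] := exS; split.
  have [[_ geoG _] _] := complete_sound (geodesic_bouquet hne)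
    (@bouquet_loop _ _ h) (reach_bouquet hne) cG.
  have realG : {in Gm, forall e, realizes h (@spoke _ _ h) (org e)
      (of_label (mu e)) (tgt e) (nu e)} by move=> e /geoG[].
  have := geodesic_loop_sound (x := 1) realG loop _ uS.
  rewrite prod_fword /= mulg1 mul1g; apply=> p; rewrite inE => /eqP->.
  by rewrite /= gamma1 mulg1.
move=> u' gam_u'; have [v vS le_v] := exec_le _ _ exS gam_u'.
have func : {in S &, forall p q, p.1 = q.1 -> p = q}.
  apply: geodesic_loop_functional loop _ => p q.
  by rewrite !inE => /eqP-> /eqP->.
by have [->] := func _ _ uS vS erefl.
Qed.
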